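(* Let $A$ be a ring. Let $B$ be an $A$-algebra. Let $(I_\rho)_{\rho\in\mathbb{N}}$ be an ideal semifiltration of $A$. Let $v\in B$ and $u\in B$. Let $m\in\mathbb{N}$ and $n\in\mathbb{N}$. (a) The sequence $\left(I_\rho A[v]\right)_{\rho\in\mathbb{N}}$ is an ideal semifiltration of $A[v]$. (b) Assume that $v$ is $m$-integral over $A$, and that $u$ is $n$-integral over $\left(A[v],(I_\rho A[v])_{\rho\in\mathbb{N}}\right)$. Then $u$ is $nm$-integral over $\left(A,(I_\rho)_{\rho\in\mathbb{N}}\right)$.
   Context: All rings are commutative with unity, and ''$A$-algebra'' means commutative unital $A$-algebra (the structure map $A\to B$ need not be injective). $\mathbb{N}=\{0,1,2,\ldots\}$. For an $A$-algebra $B$ and $v\in B$, $A[v]=\{P(v)\mid P\in A[X]\}$ is the $A$-subalgebra of $B$ generated by $v$; $B$ is an $A[v]$-algebra since $A[v]$ is a subring of $B$. For an ideal $I$ of $A$, $IA[v]$ means $I\cdot(A[v])$, the ideal of $A[v]$ consisting of finite sums of products $ab$ with $a\in I$, $b\in A[v]$. For a ring $A$, an $A$-algebra $B$ and $n\in\mathbb{N}$, an element $u\in B$ is called $n$-integral over $A$ if there exists a monic polynomial $P\in A[X]$ with $\deg P=n$ (that is, $P=X^n+\sum_{k=0}^{n-1}a_kX^k$ with $a_k\in A$) and $P(u)=0$. An ideal semifiltration of a ring $A$ is a sequence $(I_\rho)_{\rho\in\mathbb{N}}$ of ideals of $A$ such that $I_0=A$ and $I_aI_b\subseteq I_{a+b}$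 for all $a,b\in\mathbb{N}$. Given an ideal semifiltration $(I_\rho)_{\rho\in\mathbb{N}}$ of a ring $A$, an element $u$ of an $A$-algebra $B$ is called $n$-integral over $(A,(I_\rho)_{\rho\in\mathbb{N}})$ if there exists $(a_0,a_1,\ldots,a_n)\in A^{n+1}$ such that $\sum_{k=0}^{n}a_ku^k=0$, $a_n=1$, and $a_i\in I_{n-i}$ for every $i\in\{0,1,\ldots,n\}$. *)

(* Defs.v *)
From HB Require Import structures.
From mathcomp Require Import all_boot all_algebra.
From mathcomp Require Import boolp classical_sets.

Set Implicit Arguments.
Unset Strict Implicit.
Unset Printing Implicit Defensive.
Import GRing.Theory.
Local Open Scope ring_scope.
Local Open Scope classical_set_scope.

(* Rings are comPzRingType, so the zero ring is allowed; an A-algebra B is a   *)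
(* ring B with its structure map f : {rmorphism A -> B} (as for integralOver   *)
(* in mxpoly). The library's comAlgType, {poly _} and idealr all exclude the   *)
(* zero ring (and idealr also excludes the unit ideal), so polynomials are     *)
(* given here by their coefficients and ideals by classical sets.              *)

(* The finite sums of products x * y with x in X and y in Y. This is the ideal *)
(* product when X and Y are ideals.                                            *)
Definition mulset (R : comPzRingType) (X Y : set R) : set R :=
  [set z | exists k : nat, exists x y : 'I_k -> R,
    (forall i, X (x i) /\ Y (y i)) /\ z = \sum_(i < k) x i * y i].

Definition is_ideal (R : comPzRingType) (I : set R) : Prop :=
  [/\ I 0, forall x y, I x -> I y -> I (x + y) & forall a x, I x -> I (a * x)].

Definition ideal_semifiltration (R : comPzRingType) (I : nat -> set R) : Prop :=
  [/\ forall r, is_ideal (I r), I 0%N = setT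
    & forall a b, mulset (I a) (I b) `<=` I (a + b)%N].

(* The coefficients of X^0, ..., X^(n-1) in the monic P of degree n are given  *)
(* by a; the leading coefficient is the explicit term u ^+ n.                  *)
Definition integral (A B : comPzRingType) (f : {rmorphism A -> B}) (n : nat)
    (u : B) : Prop :=
  exists a : 'I_n -> A, u ^+ n + \sum_(k < n) f (a k) * u ^+ k = 0.

Definition integral_semifil (A B : comPzRingType) (f : {rmorphism A -> B})
    (I : nat -> set A) (n : nat) (u : B) : Prop :=
  exists a : 'I_n.+1 -> A,
    [/\ \sum_(k < n.+1) f (a k) * u ^+ k = 0, a ord_max = 1
      & forall i : 'I_n.+1, I (n - i)%N (a i)].

(* P(v) for the polynomial P with coefficient sequence s, trailing zeros       *)
(* allowed.                                                                    *)
Definition peval (A B : comPzRingType) (f : {rmorphism A -> B}) (v : B)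
    (s : seq A) : B :=
  \sum_(i < size s) f s`_i * v ^+ i.

Definition adjoin_pred (A B : comPzRingType) (f : {rmorphism A -> B}) (v : B) :
    {pred B} :=
  [pred b | `[< exists s : seq A, b = peval f v s >]].

Section Adjoin.
Variables (A B : comPzRingType) (f : {rmorphism A -> B}) (v : B).

Lemma adjoin_predP (b : B) :
  reflect (exists s : seq A, b = peval f v s) (b \in adjoin_pred f v).
Proof. exact: asboolP. Qed.

Lemma peval_cons (a : A) (s : seq A) :
  peval f v (a :: s) = f a + v * peval f v s.
Proof.
rewrite /peval /= big_ord_recl /= expr0 mulr1; congr (_ + _).
by rewrite mulr_sumr; apply: eq_bigr => i _; rewrite /= exprS mulrCA.
Qed.

Lemma peval_nil : peval f v [::] = 0.
Proof. by rewrite /peval big_ord0. Qed.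

Lemma peval_const (a : A) : peval f v [:: a] = f a.
Proof. by rewrite peval_cons peval_nil mulr0 addr0. Qed.

Lemma pevalD (s t : seq A) :
  exists r : seq A, peval f v s + peval f v t = peval f v r.
Proof.
elim: s t => [|a s IHs] t; first by exists t; rewrite peval_nil add0r.
case: t => [|b t]; first by exists (a :: s); rewrite peval_nil addr0.
have [r er] := IHs t; exists (a + b :: r).
by rewrite !peval_cons -er rmorphD mulrDr addrACA.
Qed.

Lemma pevalZ (c : A) (s : seq A) :
  f c * peval f v s = peval f v [seq c * a | a <- s].
Proof.
elim: s => [|a s IHs]; first by rewrite /= !peval_nil mulr0.
by rewrite /= !peval_cons -IHs mulrDr rmorphM mulrCA.
Qed.

Lemma pevalM (s t : seq A) :
  exists r : seq A, peval f v s * peval f v t = peval f v r.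
Proof.
elim: s => [|a s [r er]]; first by exists [::]; rewrite peval_nil mul0r.
have [q eq_q] := pevalD [seq a * b | b <- t] (0 :: r).
exists q; rewrite -eq_q -pevalZ !peval_cons -er.
by rewrite mulrDl rmorph0 add0r mulrA.
Qed.

Lemma adjoin_subring_closed : subring_closed (adjoin_pred f v).
Proof.
split.
- by apply/adjoin_predP; exists [:: 1]; rewrite peval_const rmorph1.
- move=> _ _ /adjoin_predP[s ->] /adjoin_predP[t ->]; apply/adjoin_predP.
  have [r er] := pevalD s [seq -1 * a | a <- t].
  by exists r; rewrite -er -pevalZ rmorphN1 mulN1r.
- move=> _ _ /adjoin_predP[s ->] /adjoin_predP[t ->]; apply/adjoin_predP.
  exact: pevalM.
Qed.

(* The ring A[v].                                                              *)
Record adjoin := Adjoin { adjoin_val : B; _ : adjoin_val \in adjoin_pred f v }.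

HB.instance Definition _ := [isSub for adjoin_val].
HB.instance Definition _ := [Choice of adjoin by <:].
HB.instance Definition _ :=
  GRing.SubChoice_isSubComPzRing.Build B (adjoin_pred f v) adjoin
    adjoin_subring_closed.

(* The inclusion A[v] -> B, through which B is an A[v]-algebra.                *)
Definition adjoin_incl : {rmorphism adjoin -> B} := val : adjoin -> B.

Lemma adjoin_const_subproof (a : A) : f a \in adjoin_pred f v.
Proof. by apply/adjoin_predP; exists [:: a]; rewrite peval_const. Qed.

(* The structure map A -> A[v].                                                *)
Definition adjoin_const (a : A) : adjoin :=
  Adjoin (adjoin_const_subproof a).

Lemma adjoin_const_zmod_morphism : zmod_morphism adjoin_const.
Proof. by move=> x y; apply: val_inj; rewrite /= rmorphB. Qed.

Lemma adjoin_const_monoid_morphism : monoid_morphism adjoin_const.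
Proof.
by split=> [|x y]; apply: val_inj; rewrite /= ?rmorph1 ?rmorphM.
Qed.

HB.instance Definition _ :=
  GRing.isZmodMorphism.Build A adjoin adjoin_const adjoin_const_zmod_morphism.
HB.instance Definition _ :=
  GRing.isMonoidMorphism.Build A adjoin adjoin_const
    adjoin_const_monoid_morphism.

End Adjoin.

(* The ideal I A[v] of A[v].                                                   *)
Definition ideal_adjoin (A B : comPzRingType) (f : {rmorphism A -> B}) (v : B)
    (I : set A) : set (adjoin f v) :=
  mulset (adjoin_const f v @` I) setT.

Arguments ideal_adjoin {A B} f v I.

(* Main.v *)
Require Import Defs.
From HB Require Import structures.
From mathcomp Require Import all_boot perm all_algebra.
From mathcomp Require Import boolp classical_sets.
Local Open Scope ring_scope.

Set Implicit Arguments.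
Unset Strict Implicit.
Unset Printing Implicit Defensive.
Import GRing.Theory.
Local Open Scope classical_set_scope.

(** The determinant trick, with degrees.  Let [v] be a root of a monic
    polynomial of degree [m] over [A], and let [u] satisfy a monic equation of
    degree [n] whose coefficient [b_i] lies in [I_(n-i) A[v]].  For [m, n > 0]
    the [n m] monomials [u^i v^j] with [i < n], [j < m] span an [A]-module that
    contains [1] and is stable under multiplication by [u]: if [i + 1 < n], then
    [u (u^i v^j)] is again one of the monomials, and [u (u^(n-1) v^j)] is minus
    the sum of the [b_i v^j u^i], where [b_i v^j] lies in [I_(n-i) A[v]] and so,
    by the equation of [v], is a combination of [1, ..., v^(m-1)] with
    coefficients in the same ideal [I_(n-i)] ([power_span_ideal_adjoin]).
    Hence [u] is a root of the characteristic polynomial of the matrix [M] of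
    this multiplication, a monic polynomial of degree [n m] over [A].

    The degrees come for free.  If [u^i v^j] is given weight [i], each entry of
    [M] from a monomial of weight [i] to one of weight [i'] lies in
    [I_(i + 1 - i')], and is zero when [i + 1 < i'].  So [X - M] is homogeneous
    in the Rees algebra, the weights cancel in each term of its determinant, and
    the coefficient of [X^k] lies in [I_(nm - k)] ([char_poly_coef_semifil]).

    When [B] is the zero ring the conclusion is trivial.  This case is separated
    because the determinant argument is carried out over nonzero rings; it also
    covers [m = 0] and [n = 0], as a monic equation of degree [0] says [1 = 0]. *)

(** * Ideals, products of sets and semifiltrations *)

Lemma is_ideal_sum (R : comPzRingType) (J : set R) (T : finType) (F : T -> R) :
  is_ideal J -> (forall t, J (F t)) -> J (\sum_t F t).
Proof. by move=> [J0 JD _] JF; apply: (big_ind J). Qed.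

Lemma is_idealN (R : comPzRingType) (J : set R) (x : R) :
  is_ideal J -> J x -> J (- x).
Proof. by move=> [_ _ JM] Jx; rewrite -mulN1r; apply: JM. Qed.

Lemma mulset_prod (R : comPzRingType) (X Y : set R) (x y : R) :
  X x -> Y y -> mulset X Y (x * y).
Proof.
move=> Xx Yy; exists 1%N, (fun=> x), (fun=> y); split=> //.
by rewrite big_ord1.
Qed.

Lemma mulset0 (R : comPzRingType) (X Y : set R) : mulset X Y 0.
Proof.
by exists 0%N, (fun=> 0), (fun=> 0); split=> [[]//|]; rewrite big_ord0.
Qed.

Lemma mulsetD (R : comPzRingType) (X Y : set R) (z z' : R) :
  mulset X Y z -> mulset X Y z' -> mulset X Y (z + z').
Proof.
move=> [k [x [y [XYxy ->]]]] [l [x' [y' [XYxy' ->]]]].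
pose glue (g : 'I_k -> R) h (i : 'I_(k + l)) :=
  match split i with inl j => g j | inr j => h j end.
exists (k + l)%N, (glue x x'), (glue y y'); split=> [i|].
  by rewrite /glue; case: (split i).
rewrite big_split_ord /glue; congr (_ + _); apply: eq_bigr => i _.
  by rewrite (unsplitK (inl i)).
by rewrite (unsplitK (inr i)).
Qed.

Lemma mulset_sum (R : comPzRingType) (X Y : set R) (T : finType) (F : T -> R) :
  (forall t, mulset X Y (F t)) -> mulset X Y (\sum_t F t).
Proof.
by move=> XYF; apply: (big_ind (mulset X Y)) => //;
  [exact: mulset0|exact: mulsetD].
Qed.

Lemma mulset_setT_ideal (R : comPzRingType) (X : set R) :
  is_ideal (mulset X setT).
Proof.
split; [exact: mulset0|exact: mulsetD|].
move=> a _ [k [x [y [XYxy ->]]]]; rewrite mulr_sumr; apply: mulset_sum => i.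
by rewrite mulrCA; apply: mulset_prod => //; case: (XYxy i).
Qed.

Lemma ideal_adjoin_semifiltration (A B : comPzRingType)
    (f : {rmorphism A -> B}) (I : nat -> set A) (v : B) :
  ideal_semifiltration I ->
  ideal_semifiltration (fun r => ideal_adjoin f v (I r)).
Proof.
move=> [_ I0 IM]; split=> [r||a b _ [k [x [y [Ixy ->]]]]].
- exact: mulset_setT_ideal.
- rewrite predeqE => z; split=> // _; rewrite -[z]mul1r.
  apply: mulset_prod => //; exists 1; last exact: rmorph1.
  by rewrite I0.
- apply: mulset_sum => i; have [] := Ixy i.
  move=> [p [g [h [gP ->]]]] [q [g' [h' [g'P ->]]]].
  rewrite mulr_suml; apply: mulset_sum => j.
  rewrite mulr_sumr; apply: mulset_sum => l.
  rewrite mulrACA; apply: mulset_prod => //.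
  have [[c Ic <-] _] := gP j; have [[d Id <-] _] := g'P l.
  exists (c * d); last exact: rmorphM.
  exact/IM/mulset_prod.
Qed.

(** * The determinant trick for a semifiltration *)

(** The ideal of degree [d - e], an integer that may be negative.  In negative
    degree it has to be zero: a semifiltration need not be decreasing, so the
    choice of the whole ring would break multiplicativity. *)
Definition shifted_ideal (A : comPzRingType) (I : nat -> set A) (e d : nat) :
    set A :=
  [set a | if (e <= d)%N then I (d - e)%N a else a = 0].

Section Shifted.
Variables (A : comPzRingType) (I : nat -> set A).
Hypothesis hI : ideal_semifiltration I.

Lemma shifted_is_ideal e d : is_ideal (shifted_ideal I e d).
Proof.
have [Iid _ _] := hI; rewrite /shifted_ideal; case: leqP => _; first exact: Iid.
by split=> /= [|x y -> ->|a x ->]; rewrite ?addr0 ?mulr0.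
Qed.

Lemma shifted_idealT d x : shifted_ideal I d d x.
Proof. by have [_ I0 _] := hI; rewrite /shifted_ideal /= leqnn subnn I0. Qed.

Lemma shifted_idealM e d e' d' x y :
  shifted_ideal I e d x -> shifted_ideal I e' d' y ->
  shifted_ideal I (e + e') (d + d') (x * y).
Proof.
have [_ _ IM] := hI.
have [S0 _ _] := shifted_is_ideal (e + e') (d + d').
rewrite {1 2}/shifted_ideal /=.
case: leqP => [le_ed Ix|_ ->]; last by rewrite mul0r.
case: leqP => [le_ed' Iy|_ ->]; last by rewrite mulr0.
rewrite /shifted_ideal /= leq_add //.
have -> : (d + d' - (e + e') = (d - e) + (d' - e'))%N.
  by rewrite subnDA -addnBAC // -addnBA.
exact/IM/mulset_prod.
Qed.

End Shifted.

Section Determinant.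
Variables (A : comNzRingType) (I : nat -> set A).
Hypothesis hI : ideal_semifiltration I.

(** With ['X] in degree one and the elements of [I r] in degree [r], these are
    the homogeneous polynomials of degree [d - e] in the Rees algebra of the
    semifiltration. *)
Definition rees_homogeneous (e d : nat) (p : {poly A}) : Prop :=
  forall k, shifted_ideal I (e + k) d p`_k.

Lemma rees_homogeneousM e d e' d' p q :
  rees_homogeneous e d p -> rees_homogeneous e' d' q ->
  rees_homogeneous (e + e') (d + d') (p * q).
Proof.
move=> hp hq k; rewrite coefM.
apply: is_ideal_sum => [|i]; first exact: shifted_is_ideal.
have -> : (e + e' + k = (e + i) + (e' + (k - i)))%N.
  by rewrite addnACA subnKC // -ltnS.
exact: shifted_idealM.
Qed.

Lemma rees_homogeneous_prod (T : finType) (e d : T -> nat) (P : T -> {poly A}) :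
  (forall t, rees_homogeneous (e t) (d t) (P t)) ->
  rees_homogeneous (\sum_t e t) (\sum_t d t) (\prod_t P t).
Proof.
move=> hP; elim: (index_enum T) => [|t s IHs].
  rewrite !big_nil => k; rewrite coef1; case: k => [|k].
    exact: shifted_idealT.
  by rewrite /shifted_ideal.
by rewrite !big_cons; apply: rees_homogeneousM.
Qed.

(** Give row and column [i] the weight [w i].  In a term of the Leibniz formula
    each row and each column is used once, so the weights cancel and only the
    degree [N] is left. *)
Lemma char_poly_coef_semifil N (w : 'I_N -> nat) (M : 'M[A]_N) :
  (forall i j, shifted_ideal I (w j) (w i).+1 (M i j)) ->
  forall k, (k <= N)%N -> I (N - k)%N (char_poly M)`_k.
Proof.
move=> hM k le_kN.
suff : shifted_ideal I (\sum_i w i + k) (\sum_i w i + N) (char_poly M)`_k.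
  by rewrite /shifted_ideal /= leq_add2l le_kN subnDl.
rewrite /char_poly /determinant coef_sum.
apply: is_ideal_sum => [|s]; first exact: shifted_is_ideal.
have: rees_homogeneous (\sum_i w (s i)) (\sum_i (w i).+1)
    (\prod_i char_poly_mx M i (s i)).
  apply: rees_homogeneous_prod => i l; rewrite !mxE coefB coefMn coefX coefC.
  have S0 e d : shifted_ideal I e d 0 by have [] := shifted_is_ideal hI e d.
  have [_ SD _] := shifted_is_ideal hI (w (s i) + l) (w i).+1.
  apply: SD.
    case: (l =P 1%N) => [->|_]; last by rewrite mul0rn; exact: S0.
    case: (i =P s i) => [<-|_]; last by rewrite mulr0n; exact: S0.
    by rewrite addn1; apply: shifted_idealT.
  apply: is_idealN; first exact: shifted_is_ideal.
  by case: (l =P 0%N) => [->|_]; rewrite ?addn0.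
have -> : (\sum_i w (s i) = \sum_i w i)%N.
  by rewrite [RHS](reindex_inj (@perm_inj _ s)).
have -> : (\sum_i (w i).+1 = \sum_i w i + N)%N.
  under eq_bigr do rewrite -addn1.
  by rewrite big_split /= sum_nat_const card_ord muln1.
move=> /(_ k); rewrite mulr_sign; case: (odd_perm s) => // hk.
by rewrite coefN; apply: is_idealN => //; apply: shifted_is_ideal.
Qed.

End Determinant.

(** The adjugate of [u - M] shows that [det (u - M)] kills every entry of [x],
    in particular the entry [1]. *)
Lemma char_poly_root_of_eigenvector (A B : comNzRingType)
    (f : {rmorphism A -> B}) N (M : 'M[A]_N) (x : 'cV[B]_N) (u : B) i :
  map_mx f M *m x = u *: x -> x i 0 = 1 -> (map_poly f (char_poly M)).[u] = 0.
Proof.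
move=> Mx xi1; rewrite map_char_poly -horner_evalE /char_poly -det_map_mx.
set D := map_mx _ _.
have DE : D = u%:M - map_mx f M.
  apply/matrixP => k l; rewrite !mxE /= /horner_eval hornerD hornerN hornerC.
  by rewrite hornerMn hornerX.
have : \det D *: x = 0.
  rewrite -mul_scalar_mx -mul_adj_mx -mulmxA DE mulmxBl Mx mul_scalar_mx.
  by rewrite subrr mulmx0.
by move/matrixP/(_ i 0); rewrite !mxE xi1 mulr1.
Qed.

(** The determinant trick.  The coordinates are indexed by any finite type, so
    that it can be applied to pairs of exponents. *)
Lemma integral_semifil_eigenvector_nz (A B : comNzRingType)
    (f : {rmorphism A -> B}) (I : nat -> set A) (T : finType) (w : T -> nat)
    (M : T -> T -> A) (x : T -> B) (t0 : T) (u : B) :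
  ideal_semifiltration I ->
  (forall s t, shifted_ideal I (w t) (w s).+1 (M s t)) ->
  (forall s, u * x s = \sum_t f (M s t) * x t) -> x t0 = 1 ->
  integral_semifil f I #|T| u.
Proof.
move=> hI hM hx x1.
pose M' : 'M[A]_#|T| := \matrix_(i, j) M (enum_val i) (enum_val j).
pose x' : 'cV[B]_#|T| := \col_i x (enum_val i).
exists (fun i => (char_poly M')`_i); split=> [||i].
- have eigen : map_mx f M' *m x' = u *: x'.
    apply/colP => i; rewrite !mxE hx.
    rewrite (big_enum_val (fun t => f (M (enum_val i) t) * x t)) /=.
    by apply: eq_bigr => j _; rewrite !mxE.
  have x'1 : x' (enum_rank t0) 0 = 1 by rewrite mxE enum_rankK.
  rewrite -[RHS](char_poly_root_of_eigenvector eigen x'1).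
  rewrite (@horner_coef_wide _ #|T|.+1).
    by apply: eq_bigr => i _; rewrite coef_map.
  by rewrite (leq_trans (size_poly _ _)) // size_char_poly.
- by have /monicP := char_poly_monic M'; rewrite /lead_coef size_char_poly.
- apply: (char_poly_coef_semifil hI (w := w \o enum_val)).
    by move=> k l; rewrite mxE; apply: hM.
  by rewrite -ltnS.
Qed.

(** The same over rings that may be zero: [1 <> 0] in [B] forces [1 <> 0] in
    [A], so both can be repackaged as nonzero rings. *)
Lemma integral_semifil_eigenvector (A B : comPzRingType)
    (f : {rmorphism A -> B}) (I : nat -> set A) (T : finType) (w : T -> nat)
    (M : T -> T -> A) (x : T -> B) (t0 : T) (u : B) :
  ideal_semifiltration I -> (1 : B) <> 0 ->
  (forall s t, shifted_ideal I (w t) (w s).+1 (M s t)) ->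
  (forall s, u * x s = \sum_t f (M s t) * x t) -> x t0 = 1 ->
  integral_semifil f I #|T| u.
Proof.
move=> hI B1 hM hx x1.
have A1 : (1 : A) <> 0.
  by move=> A1; apply: B1; rewrite -(rmorph1 f) A1 rmorph0.
case: A B f I M x u hI B1 hM hx x1 A1 => A cA [B cB] f I M x u hI B1 hM hx x1 A1.
move/eqP in A1; move/eqP in B1.
pose A' : comNzRingType := HB.pack A cA
  (GRing.PzSemiRing_isNonZero.Build (GRing.ComPzRing.Pack cA) A1).
pose B' : comNzRingType := HB.pack B cB
  (GRing.PzSemiRing_isNonZero.Build (GRing.ComPzRing.Pack cB) B1).
exact: (@integral_semifil_eigenvector_nz A' B' f I T w M x t0 u).
Qed.

(** * Reduction modulo the equation of v *)

(** The coefficients are confined to [J] so that reduction modulo the equation of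
    [v] keeps track of degrees. *)
Definition power_span (A B : comPzRingType) (f : {rmorphism A -> B}) (v : B)
    (m : nat) (J : set A) : set B :=
  [set z | exists2 c : 'I_m -> A,
     forall j, J (c j) & z = \sum_j f (c j) * v ^+ j].

Section PowerSpan.
Variables (A B : comPzRingType) (f : {rmorphism A -> B}) (v : B) (m : nat).
Variable J : set A.
Hypothesis Jideal : is_ideal J.

Lemma power_spanD y z :
  power_span f v m J y -> power_span f v m J z -> power_span f v m J (y + z).
Proof.
have [_ JD _] := Jideal.
move=> [c Jc ->] [d Jd ->]; exists (fun j => c j + d j) => [j|]; first exact: JD.
by rewrite -big_split; apply: eq_bigr => j _; rewrite rmorphD mulrDl.
Qed.

Lemma power_spanZ a z :
  power_span f v m J z -> power_span f v m J (f a * z).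
Proof.
have [_ _ JM] := Jideal.
move=> [c Jc ->]; exists (fun j => a * c j) => [j|]; first exact: JM.
by rewrite mulr_sumr; apply: eq_bigr => j _; rewrite rmorphM mulrA.
Qed.

Lemma power_span0 : power_span f v m J 0.
Proof.
have [J0 _ _] := Jideal; exists (fun=> 0) => //.
by rewrite big1 // => j _; rewrite rmorph0 mul0r.
Qed.

Lemma power_span_sum (T : finType) (F : T -> B) :
  (forall t, power_span f v m J (F t)) -> power_span f v m J (\sum_t F t).
Proof.
move=> SF; apply: (big_ind (power_span f v m J)) => //.
  exact: power_span0.
exact: power_spanD.
Qed.

Lemma power_span_monomial c (j : 'I_m) : J c -> power_span f v m J (f c * v ^+ j).
Proof.
have [J0 _ _] := Jideal.
move=> Jc; exists (fun i => if i == j then c else 0) => [i|]; first by case: eqP.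
rewrite (bigD1 j) //= eqxx big1 ?addr0 // => i /negbTE ->.
by rewrite rmorph0 mul0r.
Qed.

Hypothesis v_int : integral f m v.

(** Only the top monomial [v^(m-1)] needs the equation of [v]; its coefficients
    multiply an element of [J] into [J]. *)
Lemma power_span_mul_gen z :
  power_span f v m J z -> power_span f v m J (v * z).
Proof.
have [_ _ JM] := Jideal.
move=> [c Jc ->]; rewrite mulr_sumr; apply: power_span_sum => j.
rewrite mulrCA -exprS; have [lt_jm|ge_jm] := ltnP j.+1 m.
  exact: (power_span_monomial (Ordinal lt_jm)).
have -> : j.+1 = m by apply/eqP; rewrite eqn_leq ltn_ord.
have [a /eqP] := v_int; rewrite addr_eq0 => /eqP ->.
rewrite mulrN -mulNr -rmorphN mulr_sumr; apply: power_span_sum => k.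
rewrite mulrA -rmorphM; apply: power_span_monomial.
rewrite mulrC; apply: JM; apply: is_idealN => //; exact: Jc.
Qed.

Lemma power_span_mul_exp k z :
  power_span f v m J z -> power_span f v m J (z * v ^+ k).
Proof.
move=> Sz; elim: k => [|k IHk]; first by rewrite mulr1.
by rewrite exprS mulrCA; apply: power_span_mul_gen.
Qed.

(** The equation of [v] lowers exponents without leaving the ideal [J], which is
    what keeps the degrees intact in the reduction to [A]. *)
Lemma power_span_ideal_adjoin (z : adjoin f v) :
  ideal_adjoin f v J z -> power_span f v m J (adjoin_incl f v z).
Proof.
move=> [k [x [y [xyP ->]]]]; rewrite rmorph_sum; apply: power_span_sum => i.
have [[a Ja <-] _] := xyP i.
rewrite rmorphM -[adjoin_incl f v (adjoin_const f v a)]/(f a).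
have /adjoin_predP[s ->] : adjoin_incl f v (y i) \in adjoin_pred f v.
  exact: valP (y i).
rewrite mulr_sumr; apply: power_span_sum => l.
rewrite mulrCA; apply: power_spanZ; apply: power_span_mul_exp.
(* An equation of degree 0 reads 1 = 0, so B is the zero ring. *)
have [m0|m_gt0] := posnP m.
  have [b] := v_int; move: b; rewrite m0 => b.
  rewrite big_ord0 expr0 addr0 => B1.
  by rewrite -[f a]mulr1 B1 mulr0; rewrite -m0; exact: power_span0.
by have := power_span_monomial (Ordinal m_gt0) Ja; rewrite mulr1.
Qed.

End PowerSpan.

Lemma integral_semifil_zero_ring (A B : comPzRingType) (f : {rmorphism A -> B})
    (I : nat -> set A) (n : nat) (u : B) :
  ideal_semifiltration I -> (1 : B) = 0 -> integral_semifil f I n u.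
Proof.
move=> [Iid I0 _] B1; exists (fun i => (i == ord_max)%:R); split=> [||i].
- by rewrite -[LHS]mul1r B1 mul0r.
- by rewrite eqxx.
- case: eqP => [->|_]; first by rewrite subnn I0.
  by have [] := Iid (n - i)%N.
Qed.

Lemma integral_semifil_adjoin (A B : comPzRingType) (f : {rmorphism A -> B})
    (I : nat -> set A) (v u : B) (m n : nat) :
  ideal_semifiltration I -> integral f m v ->
  integral_semifil (adjoin_incl f v) (fun r => ideal_adjoin f v (I r)) n u ->
  integral_semifil f I (n * m)%N u.
Proof.
move=> hI v_int [b [b_eq b_lead Ib]]; have [Iid I0 _] := hI.
have [B1|/eqP B1] := eqVneq (1 : B) 0; first exact: integral_semifil_zero_ring.
have [m0|m_gt0] := posnP m.
  have [a] := v_int; move: a; rewrite m0 => a.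
  by rewrite big_ord0 expr0 addr0.
have [n0|n_gt0] := posnP n.
  subst n; move: b_eq; rewrite big_ord1 mulr1.
  by rewrite (ord1 ord_max) in b_lead; rewrite b_lead rmorph1.
have u_exp : u ^+ n =
    - \sum_(i < n) adjoin_incl f v (b (widen_ord (leqnSn n) i)) * u ^+ i.
  move: b_eq; move: (adjoin_incl f v) => g.
  rewrite big_ord_recr /= b_lead rmorph1 mul1r addrC.
  by move/eqP; rewrite addr_eq0 => /eqP.
have /choice[c cP] : forall p : 'I_n * 'I_m, exists c : 'I_m -> A,
    (forall j, I (n - p.1)%N (c j)) /\
    adjoin_incl f v (b (widen_ord (leqnSn n) p.1)) * v ^+ p.2 =
    \sum_j f (c j) * v ^+ j.
  move=> [i j] /=; have := Ib (widen_ord (leqnSn n) i).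
  move/(power_span_ideal_adjoin (Iid _) v_int).
  by move/(power_span_mul_exp (Iid _) v_int j) => [c Ic eq_c]; exists c.
have -> : (n * m)%N = #|{: 'I_n * 'I_m}| by rewrite card_prod !card_ord.
(* Row s holds the coordinates of u * (u ^+ s.1 * v ^+ s.2): a unit vector,
   except when s.1 = n - 1, where u ^+ n has to be reduced. *)
pose M (s t : 'I_n * 'I_m) : A :=
  if s.1.+1 == n then - c (t.1, s.2) t.2
  else ((t.1 == s.1.+1 :> nat) && (t.2 == s.2))%:R.
apply: (@integral_semifil_eigenvector _ _ _ _ _
  (fun s => nat_of_ord s.1) M (fun s => u ^+ s.1 * v ^+ s.2)
  (Ordinal n_gt0, Ordinal m_gt0)) => //.
- move=> s t; rewrite /M; case: (s.1.+1 =P n) => [->|_].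
    rewrite /shifted_ideal /= ltnW //; apply: is_idealN => //.
    by have [] := cP (t.1, s.2).
  case: (t.1 =P s.1.+1 :> nat) => [->|_]; first exact: shifted_idealT.
  by have [] := shifted_is_ideal hI t.1 s.1.+1.
- move=> [i j] /=; rewrite mulrA -exprS.
  rewrite -(pair_bigA _
    (fun i' j' => f (M (i, j) (i', j')) * (u ^+ i' * v ^+ j'))) /=.
  rewrite /M /=; case: (i.+1 =P n) => [->|/eqP neq_in].
    rewrite u_exp mulNr mulr_suml -sumrN; apply: eq_bigr => k _.
    have [_ /= eq_c] := cP (k, j).
    rewrite mulrAC eq_c mulr_suml -sumrN; apply: eq_bigr => l _.
    by rewrite rmorphN mulNr mulrA mulrAC.
  have lt_in : (i.+1 < n)%N by rewrite ltn_neqAle neq_in ltn_ord.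
  rewrite (bigD1 (Ordinal lt_in)) //= (bigD1 j) //= !eqxx rmorph1 mul1r.
  rewrite !big1 ?addr0 // => [k neq_k|k /negbTE neq_kj].
    rewrite big1 // => l _; case: eqP => [eq_k|_]; last by rewrite rmorph0 mul0r.
    by case/eqP: neq_k; apply: val_inj.
  by rewrite neq_kj rmorph0 mul0r.
- by rewrite /= !expr0 mulr1.
Qed.

Theorem theorem2p16 (A B : comPzRingType) (f : {rmorphism A -> B})
    (I : nat -> set A) (hI : ideal_semifiltration I)
    (v u : B) (m n : nat) :
  ideal_semifiltration (fun r => ideal_adjoin f v (I r)) /\
  (integral f m v ->
   integral_semifil (adjoin_incl f v) (fun r => ideal_adjoin f v (I r)) n u ->
   integral_semifil f I (n * m)%N u).
Proof.
split; first exact: ideal_adjoin_semifiltration.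
exact: integral_semifil_adjoin.
Qed.
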